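(* Let $G_{\mathbb{C}}$ be a complex algebraic supergroup and $\Sigma$ a (standard or graded) real structure of $G_{\mathbb{C}}$. Then for every superalgebra $A$ in $\mathcal{A}$ there is a map $\Phi_A:Lie(G_{\mathbb{C}})(A)\to Lie(G_{\mathbb{C}})(A)$ such that $$\Sigma_{A(\epsilon)}(Id+\epsilon M)=Id+\epsilon\,\Phi_A(M)\qquad\text{for all } M\in Lie(G_{\mathbb{C}})(A),$$ and the collection of maps $\Phi_A$ defines a real structure on the Lie superalgebra $Lie(G_{\mathbb{C}})$.
   Context: A superalgebra is a commutative associative (unital) superalgebra $A=A_0\oplus A_1$ over $\mathbb{C}$ (commutative: $xy=(-1)^{|x||y|}yx$ for homogeneous $x,y$). It is called reduced if $A/\mathcal{I}_A^{odd}$ has no nonzero nilpotent elements, where $\mathcal{I}_A^{odd}$ is the ideal generated by $A_1$. A standard conjugation on $A$ is a map $a\mapsto\bar a$, and a graded conjugation a map $a\mapsto\tilde a$; both are additive, parity-preserving and satisfy respectively $\overline{\lambda a}=\bar\lambda\bar a$, $\overline{ab}=\bar a\bar b$, $\bar{\bar a}=a$, and $\widetilde{\lambda a}=\bar\lambda\tilde a$, $\widetilde{ab}=\tilde a\tilde b$, $\tilde{\tilde a}=(-1)^{|a|}a$ (homogeneous $a$), for $\lambda\in\mathbb{C}$. Write $\hat a$ for the conjugate in either case. Fix one of the two types. $\mathcal{A}$ is the category of reduced, finitely generated superalgebras with a conjugation of that type, with superalgebra morphisms commuting with the conjugations; $\mathcal{S}$ is the category of sets. $gl_{m|n}(A)$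 is the set of even supermatrices $\begin{pmatrix}P&Q\\R&S\end{pmatrix}$ of size $(m+n)\times(m+n)$, where $P$ ($m\times m$) and $S$ ($n\times n$) have entries in $A_0$ and $Q$ ($m\times n$), $R$ ($n\times m$) have entries in $A_1$; $GL_{m|n}(A)$ is the group of invertible ones (equivalently $P$ and $S$ invertible). A complex algebraic supergroup is a functor $G_{\mathbb{C}}:\mathcal{A}\to\mathcal{S}$ with $G_{\mathbb{C}}(A)=\{x\in GL_{m|n}(A):\mathcal{P}_l(x)=0,\ l=1,\dots,k\}$, where the $\mathcal{P}_l$ are polynomials in the matrix entries such that $G_{\mathbb{C}}(A)$ is a group; $G_{\mathbb{C}}(f)$ applies the morphism $f$ to all entries. $A(\epsilon)=(A\oplus\epsilon A)/(\epsilon^2)$ is the superalgebra of dual numbers ($\epsilon$ even), with conjugation $\widehat{x+\epsilon y}=\hat x+\epsilon\hat y$; the functors and natural transformations are also evaluated at $A(\epsilon)$. Let $p:A(\epsilon)\to A$, $p(x+\epsilon y)=x$, and, for $a\in A_0$, $v_a:A(\epsilon)\to A(\epsilon)$, $v_a(x+\epsilon y)=x+\epsilon ay$; $G_{\mathbb{C}}(v_a)$ denotes the application of $v_a$ to all entries. A real structure of $G_{\mathbb{C}}$ is a natural transformation $\Sigma:G_{\mathbb{C}}\to G_{\mathbb{C}}$ such that for all $A$: $\Sigma_A(xy)=\Sigma_A(x)\Sigma_A(y)$ and $\Sigma_A(\Sigma_A(x))=x$ for all $x,y\in G_{\mathbb{C}}(A)$, and $\Sigma_{A(\epsilon)}(G_{\mathbb{C}}(v_a)(z))=G_{\mathbb{C}}(v_{\hat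 a})(\Sigma_{A(\epsilon)}(z))$ for all $a\in A_0$ and $z\in\ker G_{\mathbb{C}}(p)$. It is standard or graded according to the type of conjugation. The Lie superalgebra of $G_{\mathbb{C}}$ is the functor $Lie(G_{\mathbb{C}}):\mathcal{A}\to\mathcal{S}$, $Lie(G_{\mathbb{C}})(A)=\ker\bigl(G_{\mathbb{C}}(p):G_{\mathbb{C}}(A(\epsilon))\to G_{\mathbb{C}}(A)\bigr)$, identified with $\{M\in gl_{m|n}(A):Id+\epsilon M\in G_{\mathbb{C}}(A(\epsilon))\}$. It is an $A_0$-module (addition and scalar multiplication of supermatrices) with Lie bracket $[M,N]_A=MN-NM$. Its grading has as even elements the block-diagonal ones ($Q=R=0$) and as odd elements the block-off-diagonal ones ($P=0$, $S=0$). A real structure on the Lie superalgebra functor $\mathcal{G}=Lie(G_{\mathbb{C}})$ is a natural transformation $\Phi:\mathcal{G}\to\mathcal{G}$ such that for all $A$, $a,b\in A_0$, $x,y\in\mathcal{G}(A)$: $\Phi_A(ax+by)=\hat a\Phi_A(x)+\hat b\Phi_A(y)$, $\Phi_A(\Phi_A(x))=x$, $\Phi_A([x,y]_A)=[\Phi_A(x),\Phi_A(y)]_A$, and $\Phi_A$ is even (it preserves the even and the odd elements of the grading). It is called standard (graded) when the conjugations are the standard (graded) ones. *)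

(* Defs.v *)
From HB Require Import structures.
From mathcomp Require Import all_boot all_order all_algebra.
From mathcomp Require Import complex reals.

Set Implicit Arguments.
Unset Strict Implicit.
Unset Printing Implicit Defensive.

Import GRing.Theory.
Local Open Scope ring_scope.

(* [par A false] is A_0 and [par A true] is A_1. *)
HB.mixin Record isSuperAlgebra (R : realType) A
    of GRing.Algebra R[i] A := {
  par : bool -> {pred A};
  par_submod : forall b, GRing.submod_closed (par b);
  par_split : forall x : A,
    exists2 x0 : A, x0 \in par false & exists2 x1 : A, x1 \in par true &
      x = x0 + x1;
  par_direct : forall x : A, x \in par false -> x \in par true -> x = 0;
  par_one : (1 : A) \in par false;
  par_mul : forall b c (x y : A),
    x \in par b -> y \in par c -> x * y \in par (b (+) c);
  par_comm : forall b c (x y : A),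
    x \in par b -> y \in par c -> x * y = (-1) ^+ (b && c) * (y * x)
}.

#[short(type="superAlgType")]
HB.structure Definition SuperAlgebra (R : realType) :=
  {A of isSuperAlgebra R A & GRing.Algebra R[i] A}.

Arguments par {R} A : rename.

Inductive conj_kind := Standard | Graded.

(* the sign \pm 1 with \hat{\hat a} = \pm a for a of parity b *)
Definition conj_sign (t : conj_kind) (b : bool) : bool :=
  match t with Standard => false | Graded => b end.

HB.mixin Record hasConjugation (R : realType) (t : conj_kind) A
    of SuperAlgebra R A := {
  hat : A -> A;
  hatD : forall x y : A, hat (x + y) = hat x + hat y;
  hat_par : forall b (x : A), x \in par A b -> hat x \in par A b;
  hatZ : forall (l : R[i]) (x : A), hat (l *: x) = (l^*)%C *: hat x;
  hatM : forall x y : A, hat (x * y) = hat x * hat y;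
  hatK : forall b (x : A), x \in par A b ->
    hat (hat x) = (-1) ^+ conj_sign t b * x
}.

#[short(type="conjSuperAlgType")]
HB.structure Definition ConjSuperAlgebra (R : realType) (t : conj_kind) :=
  {A of hasConjugation R t A & SuperAlgebra R A}.

Arguments hat {R t} {A} : rename.

Section Superalgebras.
Variables (R : realType) (t : conj_kind).

Definition two_sided_ideal (A : superAlgType R) (I : A -> Prop) : Prop :=
  [/\ I 0, forall x y, I x -> I y -> I (x + y)
    & forall x y z, I y -> I (x * y * z)].

Definition odd_ideal (A : superAlgType R) (x : A) : Prop :=
  forall I : A -> Prop, two_sided_ideal I ->
    (forall y, y \in par A true -> I y) -> I x.

(* A / odd_ideal A has no nonzero nilpotent element *)
Definition reduced (A : superAlgType R) : Prop :=
  forall (x : A) (k : nat), odd_ideal (x ^+ k) -> odd_ideal x.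

Definition finitely_generated (A : superAlgType R) : Prop :=
  exists s : seq A, forall S : {pred A}, GRing.subalg_closed S ->
    {subset s <= S} -> forall x : A, x \in S.

Record conj_morphism (A B : conjSuperAlgType R t) := ConjMorphism {
  conj_fun :> {lrmorphism A -> B};
  conj_fun_par : forall b (x : A), x \in par A b -> conj_fun x \in par B b;
  conj_fun_hat : forall x : A, conj_fun (hat x) = hat (conj_fun x)
}.

(* the objects of the category of reduced, finitely generated superalgebras
   with a conjugation of kind t *)
Record redAlg := RedAlg {
  redAlg_sort :> conjSuperAlgType R t;
  redAlg_reduced : reduced redAlg_sort;
  redAlg_fg : finitely_generated redAlg_sort
}.

End Superalgebras.

(* [DualNum x y] is x + \epsilon y *)
Record dual (A : Type) : Type := DualNum { dual_proj : A; dual_coef : A }.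
Arguments DualNum {A}.
Arguments dual_proj {A}.
Arguments dual_coef {A}.

Definition dual_in {A : nmodType} (x : A) : dual A := DualNum x 0.
Definition dual_eps {A : nzRingType} : dual A := DualNum 0 1.
Definition dual_scale {A : nzRingType} (a : A) (u : dual A) : dual A :=
  DualNum (dual_proj u) (a * dual_coef u).

Definition dual_pair (A : Type) (u : dual A) := (dual_proj u, dual_coef u).
Definition pair_dual (A : Type) (p : A * A) := DualNum p.1 p.2.
Fact dual_pairK (A : Type) : cancel (@dual_pair A) (@pair_dual A).
Proof. by case. Qed.

Fact dual_ext (A : Type) (u v : dual A) :
  dual_proj u = dual_proj v -> dual_coef u = dual_coef v -> u = v.
Proof. by case: u v => [a b] [c d] /= -> ->. Qed.

HB.instance Definition _ (A : choiceType) :=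
  Choice.copy (dual A) (can_type (@dual_pairK A)).

Section DualZmod.
Variable A : zmodType.
Implicit Types u v w : dual A.

Definition dual_zero : dual A := DualNum 0 0.
Definition dual_opp u := DualNum (- dual_proj u) (- dual_coef u).
Definition dual_add u v :=
  DualNum (dual_proj u + dual_proj v) (dual_coef u + dual_coef v).

Fact dual_addA : associative dual_add.
Proof. by move=> u v w; apply: dual_ext; rewrite /= addrA. Qed.

Fact dual_addC : commutative dual_add.
Proof. by move=> u v; apply: dual_ext; rewrite /= addrC. Qed.

Fact dual_add0 : left_id dual_zero dual_add.
Proof. by move=> u; apply: dual_ext; rewrite /= add0r. Qed.

Fact dual_addN : left_inverse dual_zero dual_opp dual_add.
Proof. by move=> u; apply: dual_ext; rewrite /= addNr. Qed.

HB.instance Definition _ := GRing.isZmodule.Build (dual A)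
  dual_addA dual_addC dual_add0 dual_addN.

End DualZmod.

Section DualRing.
Variable A : nzRingType.
Implicit Types u v w : dual A.

Definition dual_one : dual A := DualNum 1 0.
Definition dual_mul u v :=
  DualNum (dual_proj u * dual_proj v)
          (dual_proj u * dual_coef v + dual_coef u * dual_proj v).

Fact dual_mulA : associative dual_mul.
Proof.
move=> u v w; apply: dual_ext => /=; first exact: mulrA.
by rewrite mulrDr mulrDl !mulrA addrA.
Qed.

Fact dual_mul1l : left_id dual_one dual_mul.
Proof. by move=> u; apply: dual_ext; rewrite /= !mul1r ?mul0r ?addr0. Qed.

Fact dual_mul1r : right_id dual_one dual_mul.
Proof. by move=> u; apply: dual_ext; rewrite /= !mulr1 ?mulr0 ?add0r. Qed.

Fact dual_mulDl : left_distributive dual_mul +%R.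
Proof. by move=> u v w; apply: dual_ext; rewrite /= !mulrDl // addrACA. Qed.

Fact dual_mulDr : right_distributive dual_mul +%R.
Proof. by move=> u v w; apply: dual_ext; rewrite /= !mulrDr // addrACA. Qed.

Fact dual_oner_neq0 : dual_one != 0.
Proof. by apply/eqP => /(congr1 dual_proj) /eqP; rewrite oner_eq0. Qed.

HB.instance Definition _ := GRing.Zmodule_isNzRing.Build (dual A)
  dual_mulA dual_mul1l dual_mul1r dual_mulDl dual_mulDr dual_oner_neq0.

End DualRing.

Section DualSuper.
Variables (R : realType) (A : superAlgType R).
Implicit Types (l : R[i]) (u v : dual A).

Definition dual_scalar l u := DualNum (l *: dual_proj u) (l *: dual_coef u).

Fact dual_scalarA l l' u :
  dual_scalar l (dual_scalar l' u) = dual_scalar (l * l') u.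
Proof. by apply: dual_ext; rewrite /= scalerA. Qed.

Fact dual_scalar1 : left_id 1 dual_scalar.
Proof. by move=> u; apply: dual_ext; rewrite /= scale1r. Qed.

Fact dual_scalarDr : right_distributive dual_scalar +%R.
Proof. by move=> l u v; apply: dual_ext; rewrite /= scalerDr. Qed.

Fact dual_scalarDl u : {morph dual_scalar^~ u : l l' / l + l'}.
Proof. by move=> l l'; apply: dual_ext; rewrite /= scalerDl. Qed.

HB.instance Definition _ := GRing.Zmodule_isLmodule.Build R[i] (dual A)
  dual_scalarA dual_scalar1 dual_scalarDr dual_scalarDl.

Fact dual_scaleAl l u v : l *: (u * v) = (l *: u) * v.
Proof. by apply: dual_ext; rewrite /= ?scalerDr !scalerAl. Qed.

HB.instance Definition _ :=
  GRing.Lmodule_isLalgebra.Build R[i] (dual A) dual_scaleAl.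

Fact dual_scaleAr l u v : l *: (u * v) = u * (l *: v).
Proof. by apply: dual_ext; rewrite /= ?scalerDr !scalerAr. Qed.

HB.instance Definition _ :=
  GRing.Lalgebra_isAlgebra.Build R[i] (dual A) dual_scaleAr.

Definition dual_par (b : bool) : {pred dual A} :=
  [pred u | (dual_proj u \in par A b) && (dual_coef u \in par A b)].

Fact dual_par_submod b : GRing.submod_closed (dual_par b).
Proof.
have [p0 pD] := @par_submod R A b.
split=> [|l [a c] [d e]]; rewrite !inE /=; first by rewrite p0.
by case/andP=> ha hc /andP[hd he]; rewrite !pD.
Qed.

Fact dual_par_split u :
  exists2 u0 : dual A, u0 \in dual_par false &
    exists2 u1 : dual A, u1 \in dual_par true & u = u0 + u1.
Proof.
case: u => a b.
have [a0 ha0 [a1 ha1 ->]] := par_split a.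
have [b0 hb0 [b1 hb1 ->]] := par_split b.
exists (DualNum a0 b0); first by rewrite inE /= ha0.
by exists (DualNum a1 b1); first by rewrite inE /= ha1.
Qed.

Fact dual_par_direct u :
  u \in dual_par false -> u \in dual_par true -> u = 0.
Proof.
case: u => a b; rewrite !inE /= => /andP[a0 b0] /andP[a1 b1].
by rewrite (par_direct a a0 a1) (par_direct b b0 b1).
Qed.

Fact dual_par_one : (1 : dual A) \in dual_par false.
Proof.
by rewrite inE /= par_one; have [-> _] := @par_submod R A false.
Qed.

Fact par_add b (x y : A) :
  x \in par A b -> y \in par A b -> x + y \in par A b.
Proof.
by have [_ pD] := @par_submod R A b; move=> hx /(pD 1 x y hx); rewrite scale1r.
Qed.

Fact dual_par_mul b c u v :
  u \in dual_par b -> v \in dual_par c -> u * v \in dual_par (b (+) c).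
Proof.
case: u v => [x y] [z w]; rewrite !inE /= => /andP[hx hy] /andP[hz hw].
by rewrite !(par_mul, par_add).
Qed.

Fact dual_par_comm b c u v : u \in dual_par b -> v \in dual_par c ->
  u * v = (-1) ^+ (b && c) * (v * u).
Proof.
case: u v => [x y] [z w]; rewrite !inE /= => /andP[hx hy] /andP[hz hw].
have sgn (d : bool) (p q : A) : ((-1) ^+ d * DualNum p q : dual A)
    = DualNum ((-1) ^+ d * p) ((-1) ^+ d * q).
  by case: d; rewrite ?expr0 ?expr1 ?mulN1r ?mul1r.
rewrite sgn; apply: dual_ext => /=; first exact: par_comm.
by rewrite (par_comm b c x w) // (par_comm b c y z) // -mulrDr addrC.
Qed.

HB.instance Definition _ := isSuperAlgebra.Build R (dual A)
  dual_par_submod dual_par_split dual_par_direct dual_par_one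
  dual_par_mul dual_par_comm.

End DualSuper.

Section DualConj.
Variables (R : realType) (t : conj_kind) (A : conjSuperAlgType R t).
Implicit Types u v : dual A.

Definition dual_hat u : dual A := DualNum (hat (dual_proj u)) (hat (dual_coef u)).

Fact dual_hatD u v : dual_hat (u + v) = dual_hat u + dual_hat v.
Proof. by apply: dual_ext; rewrite /= hatD. Qed.

Fact dual_hat_par b u : u \in par (dual A) b -> dual_hat u \in par (dual A) b.
Proof. by case: u => x y; rewrite !inE /= => /andP[hx hy]; rewrite !hat_par. Qed.

Fact dual_hatZ (l : R[i]) u : dual_hat (l *: u) = (l^*)%C *: dual_hat u.
Proof. by apply: dual_ext; rewrite /= hatZ. Qed.

Fact dual_hatM u v : dual_hat (u * v) = dual_hat u * dual_hat v.
Proof. by apply: dual_ext; rewrite /= ?hatD !hatM. Qed.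

Fact dual_hatK b u : u \in par (dual A) b ->
  dual_hat (dual_hat u) = (-1) ^+ conj_sign t b * u.
Proof.
case: u => x y; rewrite !inE /= => /andP[hx hy].
rewrite /dual_hat /= (hatK b x hx) (hatK b y hy).
by case: (conj_sign t b); rewrite ?expr0 ?expr1 ?mulN1r ?mul1r.
Qed.

HB.instance Definition _ := hasConjugation.Build R t (dual A)
  dual_hatD dual_hat_par dual_hatZ dual_hatM dual_hatK.

End DualConj.

(* The full subcategory on which functors and natural transformations are
   evaluated: the superalgebras A of the category and their A(\epsilon),
   which are not reduced. *)
Inductive evalObj (R : realType) (t : conj_kind) :=
  | Base of redAlg R t
  | Dual of redAlg R t.

Definition evalObj_sort (R : realType) (t : conj_kind) (X : evalObj R t) :
    conjSuperAlgType R t :=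
  match X with
  | Base A => A
  | Dual A => dual A : conjSuperAlgType R t
  end.
Coercion evalObj_sort : evalObj >-> ConjSuperAlgebra.type.

Section Supergroups.
Variables (R : realType) (m n : nat).

Definition gl (A : superAlgType R) (M : 'M[A]_(m + n)) : Prop :=
  [/\ ulsubmx M \is a mxOver (par A false),
      ursubmx M \is a mxOver (par A true),
      dlsubmx M \is a mxOver (par A true)
    & drsubmx M \is a mxOver (par A false)].

Definition GL (A : superAlgType R) (M : 'M[A]_(m + n)) : Prop :=
  gl M /\ exists N, [/\ gl N, M *m N = 1%:M & N *m M = 1%:M].

(* A list of terms (coefficient, word in the matrix entries).  Words are
   noncommutative because odd entries anticommute; every polynomial in the
   supercommuting entries is represented by such a list. *)
Definition entry_poly : Type :=
  seq (R[i] * seq ('I_(m + n) * 'I_(m + n))).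

Definition entry_poly_eval (A : superAlgType R) (P : entry_poly)
    (M : 'M[A]_(m + n)) : A :=
  \sum_(u <- P) u.1 *: \prod_(ij <- u.2) M ij.1 ij.2.

Definition zero_locus (Ps : seq entry_poly) (A : superAlgType R)
    (M : 'M[A]_(m + n)) : Prop :=
  GL M /\ forall P, P \in Ps -> entry_poly_eval P M = 0.

Record supergroup (t : conj_kind) := Supergroup {
  equations : seq entry_poly;
  supergroup1 : forall A : redAlg R t, zero_locus equations (1%:M : 'M[A]_(m + n));
  supergroupM : forall (A : redAlg R t) (M N : 'M[A]_(m + n)),
    zero_locus equations M -> zero_locus equations N ->
    zero_locus equations (M *m N);
  supergroupV : forall (A : redAlg R t) (M : 'M[A]_(m + n)),
    zero_locus equations M ->
    exists N, [/\ zero_locus equations N, M *m N = 1%:M & N *m M = 1%:M]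
}.

Definition points (t : conj_kind) (G : supergroup t) (X : superAlgType R)
    (M : 'M[X]_(m + n)) : Prop :=
  zero_locus (equations G) M.

(* Maps G(X) -> G(X) are given by functions on all matrices, constrained and
   used on G(X) only; likewise for Lie(G) below. *)
Record real_structure (t : conj_kind) (G : supergroup t)
    (Sigma : forall X : evalObj R t, 'M[X]_(m + n) -> 'M[X]_(m + n)) : Prop :=
  RealStructure {
  Sigma_points : forall X M, points G M -> points G (Sigma X M);
  Sigma_natural : forall (X Y : evalObj R t) (f : conj_morphism X Y) M,
    points G M -> Sigma Y (map_mx f M) = map_mx f (Sigma X M);
  Sigma_mul : forall (A : redAlg R t) (M N : 'M[A]_(m + n)),
    points G M -> points G N ->
    Sigma (Base A) (M *m N) = Sigma (Base A) M *m Sigma (Base A) N;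
  Sigma_invol : forall (A : redAlg R t) (M : 'M[A]_(m + n)),
    points G M -> Sigma (Base A) (Sigma (Base A) M) = M;
  Sigma_dual_scale : forall (A : redAlg R t) (a : A) (z : 'M[dual A]_(m + n)),
    a \in par A false -> points G z -> map_mx dual_proj z = 1%:M ->
    Sigma (Dual A) (map_mx (dual_scale a) z)
      = map_mx (dual_scale (hat a)) (Sigma (Dual A) z)
}.

(* Id + \epsilon M *)
Definition one_eps (A : superAlgType R) (M : 'M[A]_(m + n)) :
    'M[dual A]_(m + n) :=
  1%:M + dual_eps *: map_mx dual_in M.

Definition Lie (t : conj_kind) (G : supergroup t) (A : redAlg R t)
    (M : 'M[A]_(m + n)) : Prop :=
  gl M /\ points G (one_eps M).

Definition even_mx (A : superAlgType R) (M : 'M[A]_(m + n)) : Prop :=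
  ursubmx M = 0 /\ dlsubmx M = 0.

Definition odd_mx (A : superAlgType R) (M : 'M[A]_(m + n)) : Prop :=
  ulsubmx M = 0 /\ drsubmx M = 0.

Definition bracket (A : superAlgType R) (M N : 'M[A]_(m + n)) :
    'M[A]_(m + n) :=
  M *m N - N *m M.

Record Lie_real_structure (t : conj_kind)
    (g : forall A : redAlg R t, 'M[A]_(m + n) -> Prop)
    (Phi : forall A : redAlg R t, 'M[A]_(m + n) -> 'M[A]_(m + n)) : Prop :=
  LieRealStructure {
  Phi_Lie : forall A x, g A x -> g A (Phi A x);
  Phi_natural : forall (A B : redAlg R t) (f : conj_morphism A B) x,
    g A x -> Phi B (map_mx f x) = map_mx f (Phi A x);
  Phi_semilinear : forall (A : redAlg R t) (a b : A) x y,
    a \in par A false -> b \in par A false -> g A x -> g A y ->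
    Phi A (a *: x + b *: y) = hat a *: Phi A x + hat b *: Phi A y;
  Phi_invol : forall A x, g A x -> Phi A (Phi A x) = x;
  Phi_bracket : forall A x y, g A x -> g A y ->
    Phi A (bracket x y) = bracket (Phi A x) (Phi A y);
  Phi_even : forall A x, g A x -> even_mx x -> even_mx (Phi A x);
  Phi_odd : forall A x, g A x -> odd_mx x -> odd_mx (Phi A x)
}.

End Supergroups.

Arguments Lie {R m n t} G A M.

(* Main.v *)
Require Import Defs.
From HB Require Import structures.
From mathcomp Require Import all_boot all_order all_algebra.
From mathcomp Require Import complex reals.

(** The map \Phi_A is the \epsilon-coefficient of \Sigma_{A(\epsilon)} on
    matrices Id + \epsilon M: naturality along p : A(\epsilon) -> A, together
    with \Sigma_A(Id) = Id, shows that the constant term stays Id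
    ([Sigma_one_eps]).

    The difficulty is that a real structure is only assumed multiplicative and
    involutive on reduced superalgebras, and A(\epsilon) is not reduced.
    However, reducedness is tested modulo the ideal generated by the odd part,
    so A[\theta_1, \theta_2] with two odd variables is reduced when A is, and
    \epsilon |-> \theta_2 \theta_1 embeds A(\epsilon) into it.  The embedding
    commutes with the conjugations if the \theta_i are taken to be fixed in the
    standard case, and if \theta_1 |-> \theta_2 |-> - \theta_1 in the graded
    case ([dual_embedding]).  By naturality along this injection, the group law
    of the points, the multiplicativity of \Sigma and its involutivity all pass
    to A(\epsilon) ([pointsM], [SigmaM], [SigmaK]).

    Additivity of \Phi is then multiplicativity of \Sigma on
    Id + \epsilon(M + N) = (Id + \epsilon M)(Id + \epsilon N), semilinearity
    comes from the hypothesis on the maps v_a, and naturality and involutivity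
    are inherited from \Sigma.

    For the bracket, \Sigma being multiplicative and natural along
    A -> A(\epsilon) makes \Phi equivariant under the adjoint action:
    \Phi(g x g^-1) = \Sigma(g) \Phi(x) \Sigma(g)^-1 ([Lie_diff_conj]).  Let
    emb : A(\epsilon) -> B be the above embedding and e the image of \epsilon.
    The point g = Id + e x of G(B) conjugates y into y + e [x, y], while
    \Sigma_B(g) = Id + e \Phi(x); comparing the coefficients of e in the
    equivariance formula gives \Phi([x, y]) = [\Phi(x), \Phi(y)]
    ([Lie_diff_bracket]).

    Finally, the even and the odd elements of the Lie superalgebra are the
    eigenspaces, for 1 and -1, of the parity automorphism of A acting on
    entries.  This automorphism is a morphism of the category, so that \Phi
    preserves them by naturality ([Lie_diff_even], [Lie_diff_odd]). *)

Set Implicit Arguments.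
Unset Strict Implicit.
Unset Printing Implicit Defensive.

Import GRing.Theory.
Local Open Scope ring_scope.

(** * Parity *)

Section Parity.
Variables (R : realType) (A : superAlgType R).
Implicit Types (x y : A) (b c : bool).

Lemma par0 b : (0 : A) \in par A b.
Proof. by have [] := @par_submod R A b. Qed.

Lemma parZ b (l : R[i]) x : x \in par A b -> l *: x \in par A b.
Proof.
have [_ pD] := @par_submod R A b.
by move=> hx; rewrite -[_ *: _]addr0; apply: pD => //; apply: par0.
Qed.

Lemma parN b x : x \in par A b -> - x \in par A b.
Proof. by move=> hx; rewrite -scaleN1r parZ. Qed.

Lemma parB b x y : x \in par A b -> y \in par A b -> x - y \in par A b.
Proof. by move=> hx hy; rewrite par_add // parN. Qed.

Lemma par_sum b (I : Type) (r : seq I) (F : I -> A) :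
  (forall i, F i \in par A b) -> \sum_(i <- r) F i \in par A b.
Proof.
move=> hF; apply: (big_ind (fun x => x \in par A b)) => //; first exact: par0.
by move=> x y; apply: par_add.
Qed.

Lemma par_decompose x :
  exists x0, (x0 \in par A false) && (x - x0 \in par A true).
Proof.
have [x0 h0 [x1 h1 ->]] := par_split x.
by exists x0; rewrite h0 addrAC subrr add0r.
Qed.

Definition even_part x : A := xchoose (par_decompose x).

(** The superalgebra automorphism acting by the sign of the parity. *)
Definition parity_inv x : A :=
  locked (even_part x - (x - even_part x)).

Lemma parity_invE x y : x \in par A false -> y \in par A true ->
  parity_inv (x + y) = x - y.
Proof.
move=> hx hy; rewrite /parity_inv -lock.
have /andP[h0 h1] := xchooseP (par_decompose (x + y)).
rewrite -/(even_part _) in h0 h1 *; set e := even_part _ in h0 h1 *.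
suff -> : e = x by rewrite [x + y]addrC addrK.
apply/eqP; rewrite -subr_eq0; apply/eqP; apply: par_direct; first exact: parB.
have -> : e - x = y - (x + y - e).
  by rewrite opprB [RHS]addrC opprD addrA addrNK.
exact: parB.
Qed.

Lemma parity_inv_par b x : x \in par A b -> parity_inv x = (-1) ^+ b * x.
Proof.
case: b => hx; rewrite ?mulN1r ?mul1r.
  by rewrite -[x in LHS]add0r parity_invE ?par0 // sub0r.
by rewrite -[x in LHS]addr0 parity_invE ?par0 // subr0.
Qed.

Lemma parity_inv_even x : x \in par A false -> parity_inv x = x.
Proof. by move/parity_inv_par; rewrite mul1r. Qed.

Lemma parity_inv_odd x : x \in par A true -> parity_inv x = - x.
Proof. by move/parity_inv_par; rewrite mulN1r. Qed.

Lemma parity_invD : {morph parity_inv : x y / x + y}.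
Proof.
move=> x y.
have [x0 hx0 [x1 hx1 ->]] := par_split x.
have [y0 hy0 [y1 hy1 ->]] := par_split y.
by rewrite addrACA !parity_invE ?par_add // opprD addrACA.
Qed.

Lemma parity_invZ (l : R[i]) x : parity_inv (l *: x) = l *: parity_inv x.
Proof.
have [x0 hx0 [x1 hx1 ->]] := par_split x.
by rewrite scalerDr !parity_invE ?parZ // scalerBr.
Qed.

Lemma parity_invM : {morph parity_inv : x y / x * y}.
Proof.
move=> x y.
have [x0 hx0 [x1 hx1 ->]] := par_split x.
have [y0 hy0 [y1 hy1 ->]] := par_split y.
rewrite !parity_invE // !mulrDl !mulrDr !parity_invD !mulrN !mulNr opprK.
have p00 : x0 * y0 \in par A false by apply: par_mul hx0 hy0.
have p01 : x0 * y1 \in par A true by apply: par_mul hx0 hy1.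
have p10 : x1 * y0 \in par A true by apply: par_mul hx1 hy0.
have p11 : x1 * y1 \in par A false by apply: par_mul hx1 hy1.
by rewrite !(parity_inv_even p00, parity_inv_odd p01, parity_inv_odd p10,
  parity_inv_even p11).
Qed.

Lemma parity_invK : involutive parity_inv.
Proof.
move=> x; have [x0 hx0 [x1 hx1 ->]] := par_split x.
by rewrite (parity_invE hx0 hx1) parity_invE ?parN // opprK.
Qed.

Lemma parity_inv_homo b x : x \in par A b -> parity_inv x \in par A b.
Proof.
by case: b => hx; [rewrite parity_inv_odd ?parN | rewrite parity_inv_even].
Qed.

Lemma parity_inv1 : parity_inv 1 = 1.
Proof. by rewrite parity_inv_even ?par_one. Qed.

Lemma parity_inv0 : parity_inv 0 = 0.
Proof. by rewrite parity_inv_even ?par0. Qed.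

Lemma parity_invN x : parity_inv (- x) = - parity_inv x.
Proof. by rewrite -scaleN1r parity_invZ scaleN1r. Qed.

End Parity.

Lemma conj_sign_even t : conj_sign t false = false.
Proof. by case: t. Qed.

Section Conjugation.
Variables (R : realType) (t : conj_kind) (A : conjSuperAlgType R t).

Lemma hat0 : hat (0 : A) = 0.
Proof. by apply: (addIr (hat 0)); rewrite -hatD !add0r. Qed.

Lemma hatN (x : A) : hat (- x) = - hat x.
Proof. by apply: (addIr (hat x)); rewrite -hatD !addNr hat0. Qed.

Lemma hat1 : hat (1 : A) = 1.
Proof.
have hh1 : hat (hat (1 : A)) = 1.
  by rewrite (hatK false) ?par_one // conj_sign_even expr0 mul1r.
by rewrite -[LHS]mulr1 -[X in _ * X = _]hh1 -hatM mul1r.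
Qed.

Lemma hat_parity_inv (x : A) : hat (parity_inv x) = parity_inv (hat x).
Proof.
have [x0 hx0 [x1 hx1 ->]] := par_split x.
by rewrite (parity_invE hx0 hx1) !hatD hatN parity_invE ?hat_par.
Qed.

End Conjugation.

(** * Adjoining an odd variable *)

(** [Grass x y] stands for x + \theta y, where \theta is odd and
    \theta^2 = 0. *)
Record grass (A : Type) : Type := Grass { grass_proj : A; grass_coef : A }.
Arguments Grass {A}.
Arguments grass_proj {A}.
Arguments grass_coef {A}.

Definition grass_pair (A : Type) (u : grass A) := (grass_proj u, grass_coef u).
Definition pair_grass (A : Type) (p : A * A) := Grass p.1 p.2.
Fact grass_pairK (A : Type) : cancel (@grass_pair A) (@pair_grass A).
Proof. by case. Qed.

HB.instance Definition _ (A : choiceType) :=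
  Choice.copy (grass A) (can_type (@grass_pairK A)).

Section GrassZmod.
Variable A : zmodType.
Implicit Types u v w : grass A.

Definition grass_zero : grass A := Grass 0 0.
Definition grass_opp u := Grass (- grass_proj u) (- grass_coef u).
Definition grass_add u v :=
  Grass (grass_proj u + grass_proj v) (grass_coef u + grass_coef v).

Fact grass_addA : associative grass_add.
Proof. by move=> u v w; congr Grass; apply: addrA. Qed.

Fact grass_addC : commutative grass_add.
Proof. by move=> u v; congr Grass; apply: addrC. Qed.

Fact grass_add0 : left_id grass_zero grass_add.
Proof. by case=> x y; congr Grass; apply: add0r. Qed.

Fact grass_addN : left_inverse grass_zero grass_opp grass_add.
Proof. by move=> u; congr Grass; apply: addNr. Qed.

HB.instance Definition _ := GRing.isZmodule.Build (grass A)
  grass_addA grass_addC grass_add0 grass_addN.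

End GrassZmod.

Section Grass.
Variables (R : realType) (A : superAlgType R).
Implicit Types (u v w : grass A) (l : R[i]).

Definition grass_one : grass A := Grass 1 0.
(** Moving x past \theta: x \theta = \theta (parity_inv x). *)
Definition grass_mul u v :=
  Grass (grass_proj u * grass_proj v)
        (parity_inv (grass_proj u) * grass_coef v
           + grass_coef u * grass_proj v).

Fact grass_mulA : associative grass_mul.
Proof.
move=> [x y] [z w] [u v]; congr Grass; rewrite /= ?mulrA //.
by rewrite mulrDr mulrDl parity_invM !mulrA addrA.
Qed.

Fact grass_mul1l : left_id grass_one grass_mul.
Proof.
by case=> x y; congr Grass; rewrite /= ?parity_inv1 ?mul1r ?mul0r ?addr0.
Qed.

Fact grass_mul1r : right_id grass_one grass_mul.
Proof. by case=> x y; congr Grass; rewrite /= ?mulr1 ?mulr0 ?add0r. Qed.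

Fact grass_mulDl : left_distributive grass_mul +%R.
Proof.
move=> [x y] [z w] [u v]; congr Grass; rewrite /= ?parity_invD !mulrDl //.
exact: addrACA.
Qed.

Fact grass_mulDr : right_distributive grass_mul +%R.
Proof.
move=> [x y] [z w] [u v]; congr Grass; rewrite /= !mulrDr //.
exact: addrACA.
Qed.

Fact grass_oner_neq0 : grass_one != 0.
Proof. by apply/eqP => -[] /eqP; rewrite oner_eq0. Qed.

HB.instance Definition _ := GRing.Zmodule_isNzRing.Build (grass A)
  grass_mulA grass_mul1l grass_mul1r grass_mulDl grass_mulDr grass_oner_neq0.

Definition grass_scale l u := Grass (l *: grass_proj u) (l *: grass_coef u).

Fact grass_scaleA l l' u :
  grass_scale l (grass_scale l' u) = grass_scale (l * l') u.
Proof. by congr Grass; apply: scalerA. Qed.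

Fact grass_scale1 : left_id 1 grass_scale.
Proof. by case=> x y; congr Grass; apply: scale1r. Qed.

Fact grass_scaleDr : right_distributive grass_scale +%R.
Proof. by move=> l u v; congr Grass; apply: scalerDr. Qed.

Fact grass_scaleDl u : {morph grass_scale^~ u : l l' / l + l'}.
Proof. by move=> l l'; congr Grass; apply: scalerDl. Qed.

HB.instance Definition _ := GRing.Zmodule_isLmodule.Build R[i] (grass A)
  grass_scaleA grass_scale1 grass_scaleDr grass_scaleDl.

Fact grass_scaleAl l u v : l *: (u * v) = (l *: u) * v.
Proof. by congr Grass; rewrite /= ?parity_invZ ?scalerDr !scalerAl. Qed.

HB.instance Definition _ :=
  GRing.Lmodule_isLalgebra.Build R[i] (grass A) grass_scaleAl.

Fact grass_scaleAr l u v : l *: (u * v) = u * (l *: v).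
Proof. by congr Grass; rewrite /= ?scalerDr !scalerAr. Qed.

HB.instance Definition _ :=
  GRing.Lalgebra_isAlgebra.Build R[i] (grass A) grass_scaleAr.

Lemma grassM (x y z w : A) :
  Grass x y * Grass z w = Grass (x * z) (parity_inv x * w + y * z).
Proof. by []. Qed.

Lemma grass_signM (b : bool) (x y : A) :
  (-1) ^+ b * Grass x y = Grass ((-1) ^+ b * x) ((-1) ^+ b * y).
Proof. by case: b; rewrite ?expr0 ?expr1 ?mulN1r ?mul1r. Qed.

Definition grass_par (b : bool) : {pred grass A} :=
  [pred u | (grass_proj u \in par A b) && (grass_coef u \in par A (~~ b))].

Fact grass_par_submod b : GRing.submod_closed (grass_par b).
Proof.
split=> [|l [x y] [z w]]; rewrite !inE /= ?par0 //.
by case/andP=> hx hy /andP[hz hw]; rewrite !(par_add, parZ).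
Qed.

Fact grass_par_split u :
  exists2 u0 : grass A, u0 \in grass_par false &
    exists2 u1 : grass A, u1 \in grass_par true & u = u0 + u1.
Proof.
case: u => x y.
have [x0 hx0 [x1 hx1 ->]] := par_split x.
have [y0 hy0 [y1 hy1 ->]] := par_split y.
exists (Grass x0 y1); first by rewrite inE /= hx0.
exists (Grass x1 y0); first by rewrite inE /= hx1.
by rewrite [y0 + _]addrC.
Qed.

Fact grass_par_direct u :
  u \in grass_par false -> u \in grass_par true -> u = 0.
Proof.
case: u => x y; rewrite !inE /= => /andP[x0 y1] /andP[x1 y0].
by rewrite (par_direct x x0 x1) (par_direct y y0 y1).
Qed.

Fact grass_par_one : (1 : grass A) \in grass_par false.
Proof. by rewrite inE /= par_one par0. Qed.

Fact grass_par_mul b c u v :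
  u \in grass_par b -> v \in grass_par c -> u * v \in grass_par (b (+) c).
Proof.
case: u v => [x y] [z w]; rewrite !inE /= => /andP[hx hy] /andP[hz hw].
rewrite par_mul //= par_add //.
  by rewrite -addbN par_mul // parity_inv_homo.
by rewrite -addNb par_mul.
Qed.

Fact grass_par_comm b c u v : u \in grass_par b -> v \in grass_par c ->
  u * v = (-1) ^+ (b && c) * (v * u).
Proof.
case: u v => [x y] [z w]; rewrite !inE /= => /andP[hx hy] /andP[hz hw].
rewrite !grassM grass_signM; congr Grass; first exact: par_comm.
rewrite (parity_inv_par hx) (parity_inv_par hz) -!mulrA.
rewrite (par_comm b (~~ c) x w) // (par_comm (~~ b) c y z) // addrC.
by case: b c {hx hy hz hw} => -[] /=;
  rewrite ?expr0 ?expr1 ?mulN1r ?mul1r ?mulrN ?mulNr ?opprD ?opprK.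
Qed.

HB.instance Definition _ := isSuperAlgebra.Build R (grass A)
  grass_par_submod grass_par_split grass_par_direct grass_par_one
  grass_par_mul grass_par_comm.

(** The sign on the second component is the one of \theta. *)
Lemma grass_parity_inv (x y : A) :
  parity_inv (Grass x y) = Grass (parity_inv x) (- parity_inv y).
Proof.
have [x0 hx0 [x1 hx1 ->]] := par_split x.
have [y0 hy0 [y1 hy1 ->]] := par_split y.
have -> : Grass (x0 + x1) (y0 + y1) = Grass x0 y1 + Grass x1 y0.
  by rewrite [y0 + _]addrC.
rewrite parity_invE ?inE /= ?hx0 ?hx1 // !parity_invE // opprB.
by [].
Qed.

Definition grass_in (x : A) : grass A := Grass x 0.

Lemma grass_inD : {morph grass_in : x y / x + y}.
Proof. by move=> x y; congr Grass; rewrite addr0. Qed.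

Lemma grass_inZ l : {morph grass_in : x / l *: x}.
Proof. by move=> x; congr Grass; rewrite scaler0. Qed.

Lemma grass_inM : {morph grass_in : x y / x * y}.
Proof. by move=> x y; rewrite grassM mulr0 mul0r addr0. Qed.

Lemma grass_in_par b x : x \in par A b -> grass_in x \in par (grass A) b.
Proof. by rewrite inE /= => ->; rewrite par0. Qed.

Definition grass_var : grass A := Grass 0 1.

Lemma grass_var_odd : grass_var \in par (grass A) true.
Proof. by rewrite inE /= par0 par_one. Qed.

Lemma grassE (x y : A) : Grass x y = grass_in x + grass_var * grass_in y.
Proof.
by rewrite grassM mul0r mulr0 add0r mul1r; congr Grass; rewrite ?addr0 ?add0r.
Qed.

Lemma grass_proj_exp u k : grass_proj (u ^+ k) = grass_proj u ^+ k.
Proof. by elim: k => [//|k IHk]; rewrite !exprS /= IHk. Qed.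

Lemma odd_ideal_grass_proj u : odd_ideal u -> odd_ideal (grass_proj u).
Proof.
move=> hu I [I0 ID IM] Iodd; apply: (hu (fun v => I (grass_proj v))).
  by split=> //= [v w | v w z]; [apply: ID | apply: IM].
by move=> v /andP[hv _]; apply: Iodd.
Qed.

Lemma odd_ideal_grass_in x : odd_ideal x -> odd_ideal (grass_in x).
Proof.
move=> hx I [I0 ID IM] Iodd; apply: (hx (fun y => I (grass_in y))).
  split=> // [y z hy hz | y z w hz]; first by rewrite grass_inD; apply: ID.
  by rewrite !grass_inM; apply: IM.
by move=> y hy; apply/Iodd/grass_in_par.
Qed.

(** Reducedness only concerns the quotient by the odd ideal, in which \theta
    vanishes: A[\theta] and A have the same one. *)
Lemma grass_reduced : reduced A -> reduced (grass A).
Proof.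
move=> redA u k /odd_ideal_grass_proj; rewrite grass_proj_exp => /redA.
case: u => x y /= /odd_ideal_grass_in hx I II Iodd; have [I0 ID IM] := II.
rewrite grassE; apply: ID; first exact: hx.
by rewrite -[X in X * _]mul1r; apply/IM/Iodd/grass_var_odd.
Qed.

(** The generators of A, together with \theta. *)
Lemma grass_fg : finitely_generated A -> finitely_generated (grass A).
Proof.
move=> [s gens]; exists (grass_var :: [seq grass_in x | x <- s]).
move=> S [S1 Slin SM] sS [x y].
have Sin z : grass_in z \in S.
  apply: (gens [pred a | grass_in a \in S]) => [|a hs]; last first.
    by apply: (sS (grass_in a)); rewrite inE map_f ?orbT.
  split=> [|l a b|a b]; rewrite !inE // => ha hb.
    by rewrite grass_inD grass_inZ Slin.
  by rewrite grass_inM SM.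
by rewrite grassE -[grass_in x]scale1r Slin // SM // sS // inE eqxx.
Qed.

End Grass.

(** * Adjoining two odd variables *)

(** The element Grass (Grass x0 x1) (Grass y0 y1) is
    x0 + \theta_1 x1 + \theta_2 y0 + \theta_2 \theta_1 y1. *)
Definition grass2 (A : Type) : Type := grass (grass A).

HB.instance Definition _ (R : realType) (A : superAlgType R) :=
  SuperAlgebra.copy (grass2 A) (grass (grass A)).

Lemma grass2M (R : realType) (A : superAlgType R)
    (x0 x1 y0 y1 z0 z1 w0 w1 : A) :
  Grass (Grass x0 x1) (Grass y0 y1) * Grass (Grass z0 z1) (Grass w0 w1) =
  Grass (Grass (x0 * z0) (parity_inv x0 * z1 + x1 * z0))
    (Grass (parity_inv x0 * w0 + y0 * z0)
       (x0 * w1 - parity_inv x1 * w0 + (parity_inv y0 * z1 + y1 * z0))).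
Proof.
by rewrite !grassM grass_parity_inv !grassM parity_invK mulNr.
Qed.

Section Grass2.
Variables (R : realType) (t : conj_kind) (A : conjSuperAlgType R t).
Implicit Types u v : grass2 A.

(** In the standard case both variables are fixed.  In the graded case the
    square of the conjugation must be -1 on odd elements, which one odd variable
    alone does not allow over an arbitrary A; with two, \theta_1 |-> \theta_2
    and \theta_2 |-> - \theta_1 does it.  Both choices fix
    \theta_2 \theta_1. *)
Definition grass2_hat u : grass2 A :=
  let: Grass (Grass x0 x1) (Grass y0 y1) := u in
  match t with
  | Standard => Grass (Grass (hat x0) (hat x1)) (Grass (hat y0) (hat y1))
  | Graded => Grass (Grass (hat x0) (- hat y0)) (Grass (hat x1) (hat y1))
  end.

Fact grass2_hatD u v : grass2_hat (u + v) = grass2_hat u + grass2_hat v.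
Proof.
case: u v => [[x0 x1] [y0 y1]] [[z0 z1] [w0 w1]].
rewrite /grass2_hat; case: (t) A x0 x1 y0 y1 z0 z1 w0 w1 => B * /=;
  by rewrite !hatD ?opprD.
Qed.

Fact grass2_hat_par b u :
  u \in par (grass2 A) b -> grass2_hat u \in par (grass2 A) b.
Proof.
case: u => [[x0 x1] [y0 y1]]; rewrite !inE /= !negbK.
case/andP=> /andP[hx0 hx1] /andP[hy0 hy1].
rewrite /grass2_hat; case: (t) A x0 x1 y0 y1 hx0 hx1 hy0 hy1 => B * /=;
  by rewrite ?[- _ \in _]parN !hat_par.
Qed.

Fact grass2_hatZ (l : R[i]) u : grass2_hat (l *: u) = (l^*)%C *: grass2_hat u.
Proof.
case: u => [[x0 x1] [y0 y1]].
rewrite /grass2_hat; case: (t) A x0 x1 y0 y1 => B * /=;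
  by rewrite !hatZ -?scalerN.
Qed.

Fact grass2_hatM u v : grass2_hat (u * v) = grass2_hat u * grass2_hat v.
Proof.
case: u v => [[x0 x1] [y0 y1]] [[z0 z1] [w0 w1]]; rewrite grass2M.
rewrite /grass2_hat; case: (t) A x0 x1 y0 y1 z0 z1 w0 w1 => B *;
  lazy beta iota; rewrite grass2M;
  rewrite !(hatD, hatM, hatN, hat_parity_inv, parity_invN) ?mulNr //.
congr (Grass (Grass _ _) (Grass _ _)); first by rewrite mulrN opprD.
by rewrite mulrN opprK addrACA.
Qed.

Fact grass2_hatK b u : u \in par (grass2 A) b ->
  grass2_hat (grass2_hat u) = (-1) ^+ conj_sign t b * u.
Proof.
case: u => [[x0 x1] [y0 y1]]; rewrite !inE /= !negbK.
case/andP=> /andP[hx0 hx1] /andP[hy0 hy1]; rewrite !grass_signM.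
rewrite /grass2_hat; case: (t) A x0 x1 y0 y1 hx0 hx1 hy0 hy1
  => B x0 x1 y0 y1 hx0 hx1 hy0 hy1.
  by rewrite (hatK _ _ hx0) (hatK _ _ hx1) (hatK _ _ hy0) (hatK _ _ hy1).
rewrite !hatN (hatK _ _ hx0) (hatK _ _ hx1) (hatK _ _ hy0) (hatK _ _ hy1) /=.
by case: (b); rewrite ?expr0 ?expr1 ?mulN1r ?mul1r ?opprK.
Qed.

HB.instance Definition _ := hasConjugation.Build R t (grass2 A)
  grass2_hatD grass2_hat_par grass2_hatZ grass2_hatM grass2_hatK.

End Grass2.

(** * Morphisms *)

Section Morphisms.
Variable R : realType.

Section Build.
Variables (A B : superAlgType R) (f : A -> B).
Hypothesis fD : {morph f : x y / x + y}.
Hypothesis f1 : f 1 = 1.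
Hypothesis fM : {morph f : x y / x * y}.
Hypothesis fZ : forall l : R[i], {morph f : x / l *: x}.

Fact lrmorphism_nmod : nmod_morphism f.
Proof. by split=> //; apply: (addIr (f 0)); rewrite -fD !add0r. Qed.

Definition build_lrmorphism : {lrmorphism A -> B} :=
  HB.pack f (GRing.isNmodMorphism.Build A B f lrmorphism_nmod)
    (GRing.isMonoidMorphism.Build A B f (f1, fM))
    (GRing.isScalable.Build R[i] A B *:%R f fZ).

End Build.

Section DualScale.
Variable A : superAlgType R.

Lemma even_comm (a x : A) : a \in par A false -> a * x = x * a.
Proof.
move=> ha; have [x0 hx0 [x1 hx1 ->]] := par_split x.
by rewrite mulrDl mulrDr (par_comm _ _ _ _ ha hx0) (par_comm _ _ _ _ ha hx1)
  !expr0 !mul1r.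
Qed.

Variables (a : A) (ha : a \in par A false).

Fact dual_scaleD : {morph dual_scale a : u v / u + v}.
Proof. by move=> u v; congr DualNum; apply: mulrDr. Qed.

Fact dual_scale_one : dual_scale a 1 = 1.
Proof. by congr DualNum; apply: mulr0. Qed.

Fact dual_scaleM : {morph dual_scale a : u v / u * v}.
Proof.
move=> [x y] [z w]; congr DualNum; rewrite /= mulrDr !mulrA.
by rewrite -(even_comm x ha).
Qed.

Fact dual_scaleZ (l : R[i]) : {morph dual_scale a : u / l *: u}.
Proof. by move=> u; congr DualNum; rewrite /= scalerAr. Qed.

Definition dual_scale_lrmorphism : {lrmorphism dual A -> dual A} :=
  build_lrmorphism dual_scaleD dual_scale_one dual_scaleM dual_scaleZ.

Lemma dual_scale_par b u :
  u \in par (dual A) b -> dual_scale a u \in par (dual A) b.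
Proof.
case: u => x y; rewrite !inE /= => /andP[-> hy] /=.
exact: (par_mul false b).
Qed.

End DualScale.

Section Conj.
Variable t : conj_kind.

Section Unary.
Variable A : conjSuperAlgType R t.

Definition parity_morphism : conj_morphism A A.
Proof.
exists (build_lrmorphism (@parity_invD _ A) (parity_inv1 A)
  (@parity_invM _ A) (@parity_invZ _ A)).
- exact: parity_inv_homo.
- by move=> x; rewrite /= hat_parity_inv.
Defined.

Definition dual_proj_morphism : conj_morphism (dual A) A.
Proof.
unshelve eexists (build_lrmorphism (f := @dual_proj A) _ _ _ _) => //.
by move=> b u /andP[].
Defined.

Fact dual_inD : {morph @dual_in A : x y / x + y}.
Proof. by move=> x y; congr DualNum; rewrite addr0. Qed.

Fact dual_inM : {morph @dual_in A : x y / x * y}.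
Proof. by move=> x y; congr DualNum; rewrite mulr0 mul0r addr0. Qed.

Fact dual_inZ (l : R[i]) : {morph @dual_in A : x / l *: x}.
Proof. by move=> x; congr DualNum; rewrite scaler0. Qed.

Definition dual_in_morphism : conj_morphism A (dual A).
Proof.
exists (build_lrmorphism dual_inD (erefl : dual_in 1 = 1) dual_inM dual_inZ).
- by move=> b x hx; rewrite inE /= hx par0.
- by move=> x; congr DualNum; rewrite hat0.
Defined.

Lemma hat_grass2 (x y : A) :
  hat (Grass (Grass x 0) (Grass 0 y) : grass2 A) =
  Grass (Grass (hat x) 0) (Grass 0 (hat y)).
Proof.
rewrite /hat /= /grass2_hat.
by case: (t) A x y => B x y; rewrite !hat0 ?oppr0.
Qed.

Definition dual_grass2 (u : dual A) : grass2 A :=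
  Grass (Grass (dual_proj u) 0) (Grass 0 (dual_coef u)).

Fact dual_grass2D : {morph dual_grass2 : u v / u + v}.
Proof.
by move=> u v; congr (Grass (Grass _ _) (Grass _ _)); rewrite /= addr0.
Qed.

Fact dual_grass2M : {morph dual_grass2 : u v / u * v}.
Proof.
move=> u v; rewrite grass2M !parity_inv0.
by rewrite !(mul0r, mulr0, oppr0, add0r, addr0).
Qed.

Fact dual_grass2Z (l : R[i]) : {morph dual_grass2 : u / l *: u}.
Proof.
by move=> u; congr (Grass (Grass _ _) (Grass _ _)); rewrite /= scaler0.
Qed.

Definition dual_grass2_morphism : conj_morphism (dual A) (grass2 A).
Proof.
exists (build_lrmorphism dual_grass2D (erefl : dual_grass2 1 = 1)
  dual_grass2M dual_grass2Z).
- by move=> b [x y]; rewrite !inE /= negbK => /andP[-> ->]; rewrite !par0.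
- by move=> u; rewrite /= hat_grass2.
Defined.

Lemma dual_grass2_inj : injective dual_grass2.
Proof. by move=> [x y] [z w] []-> ->. Qed.

End Unary.

Definition conj_comp (A B C : conjSuperAlgType R t)
    (g : conj_morphism B C) (f : conj_morphism A B) : conj_morphism A C.
Proof.
exists (g \o f : {lrmorphism A -> C}).
- by move=> b x hx; do 2!apply: conj_fun_par.
- by move=> x; rewrite /= !conj_fun_hat.
Defined.

Section DualMap.
Variables (A B : conjSuperAlgType R t) (f : conj_morphism A B).

Definition dual_map (u : dual A) : dual B :=
  DualNum (f (dual_proj u)) (f (dual_coef u)).

Fact dual_mapD : {morph dual_map : u v / u + v}.
Proof. by move=> u v; congr DualNum; apply: rmorphD. Qed.

Fact dual_map1 : dual_map 1 = 1.
Proof. by congr DualNum; rewrite ?rmorph1 ?rmorph0. Qed.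

Fact dual_mapM : {morph dual_map : u v / u * v}.
Proof. by move=> u v; congr DualNum; rewrite /= ?rmorphD !rmorphM. Qed.

Fact dual_mapZ (l : R[i]) : {morph dual_map : u / l *: u}.
Proof. by move=> u; congr DualNum; apply: linearZ. Qed.

Definition dual_map_morphism : conj_morphism (dual A) (dual B).
Proof.
exists (build_lrmorphism dual_mapD dual_map1 dual_mapM dual_mapZ).
- move=> b [x y]; rewrite !inE /= => /andP[hx hy].
  by rewrite !conj_fun_par.
- by move=> u; congr DualNum; rewrite conj_fun_hat.
Defined.

End DualMap.
End Conj.
End Morphisms.

(** The superalgebra A(\epsilon), which is outside the category, embeds into the
    object A[\theta_1, \theta_2] by \epsilon |-> \theta_2 \theta_1. *)
Lemma dual_embedding (R : realType) (t : conj_kind) (A : redAlg R t) :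
  exists (B : redAlg R t) (emb : conj_morphism (Dual A) (Base B)),
    injective emb.
Proof.
exists (RedAlg (redAlg_sort := grass2 A)
  (grass_reduced (grass_reduced (@redAlg_reduced R t A)))
  (grass_fg (grass_fg (@redAlg_fg R t A)))).
by exists (dual_grass2_morphism A); apply: dual_grass2_inj.
Qed.

(** * Supermatrices *)

Section Supermatrices.
Variables (R : realType) (m n : nat).

(** Whether a row or column index belongs to the odd block. *)
Definition odd_index (i : 'I_(m + n)) : bool := (m <= i)%N.

Lemma odd_index_lshift (i : 'I_m) : odd_index (lshift n i) = false.
Proof. by rewrite /odd_index /= leqNgt ltn_ord. Qed.

Lemma odd_index_rshift (i : 'I_n) : odd_index (rshift m i) = true.
Proof. by rewrite /odd_index /= leq_addr. Qed.

Lemma glP (A : superAlgType R) (M : 'M[A]_(m + n)) :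
  gl M <-> forall i j, M i j \in par A (odd_index i (+) odd_index j).
Proof.
split=> [[/mxOverP hul /mxOverP hur /mxOverP hdl /mxOverP hdr] i j | hM].
  case: (split_ordP i) => k ->; case: (split_ordP j) => l ->;
    rewrite ?(odd_index_lshift, odd_index_rshift) /=.
  - by have := hul k l; rewrite !mxE.
  - by have := hur k l; rewrite !mxE.
  - by have := hdl k l; rewrite !mxE.
  - by have := hdr k l; rewrite !mxE.
split; apply/mxOverP => i j; rewrite !mxE.
- by have := hM (lshift n i) (lshift n j); rewrite !odd_index_lshift.
- by have := hM (lshift n i) (rshift m j);
    rewrite odd_index_lshift odd_index_rshift.
- by have := hM (rshift m i) (lshift n j);
    rewrite odd_index_lshift odd_index_rshift.
- by have := hM (rshift m i) (rshift m j); rewrite !odd_index_rshift.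
Qed.

Lemma even_mxP (A : superAlgType R) (M : 'M[A]_(m + n)) :
  even_mx M <-> forall i j, odd_index i (+) odd_index j -> M i j = 0.
Proof.
split=> [[/matrixP hur /matrixP hdl] i j | hM].
  case: (split_ordP i) => k ->; case: (split_ordP j) => l ->;
    rewrite ?(odd_index_lshift, odd_index_rshift) //= => _.
  - by have := hur k l; rewrite !mxE.
  - by have := hdl k l; rewrite !mxE.
by split; apply/matrixP => i j; rewrite !mxE hM //
  odd_index_lshift odd_index_rshift.
Qed.

Lemma odd_mxP (A : superAlgType R) (M : 'M[A]_(m + n)) :
  odd_mx M <-> forall i j, ~~ (odd_index i (+) odd_index j) -> M i j = 0.
Proof.
split=> [[/matrixP hul /matrixP hdr] i j | hM].
  case: (split_ordP i) => k ->; case: (split_ordP j) => l ->;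
    rewrite ?(odd_index_lshift, odd_index_rshift) //= => _.
  - by have := hul k l; rewrite !mxE.
  - by have := hdr k l; rewrite !mxE.
by split; apply/matrixP => i j; rewrite !mxE hM //
  ?odd_index_lshift ?odd_index_rshift.
Qed.

Section Closure.
Variable A : superAlgType R.
Implicit Types (M N : 'M[A]_(m + n)) (z w : 'M[dual A]_(m + n)).

Lemma glD M N : gl M -> gl N -> gl (M + N).
Proof. by move=> /glP hM /glP hN; apply/glP => i j; rewrite mxE par_add. Qed.

Lemma glZ (a : A) M : a \in par A false -> gl M -> gl (a *: M).
Proof.
by move=> ha /glP hM; apply/glP => i j; rewrite mxE (par_mul false).
Qed.

Lemma glN M : gl M -> gl (- M).
Proof. by move=> /glP hM; apply/glP => i j; rewrite mxE parN. Qed.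

Lemma glM M N : gl M -> gl N -> gl (M *m N).
Proof.
move=> /glP hM /glP hN; apply/glP => i j; rewrite mxE par_sum // => k.
have -> : odd_index i (+) odd_index j =
    (odd_index i (+) odd_index k) (+) (odd_index k (+) odd_index j).
  by rewrite addbA -(addbA (odd_index i)) addbb addbF.
exact: par_mul.
Qed.

Lemma gl_bracket M N : gl M -> gl N -> gl (bracket M N).
Proof. by move=> hM hN; rewrite /bracket; apply/glD/glN; apply: glM. Qed.

Lemma gl1 : gl (1%:M : 'M[A]_(m + n)).
Proof.
apply/glP => i j; rewrite mxE; case: eqP => [-> | _]; last exact: par0.
by rewrite addbb par_one.
Qed.

Lemma GLM M N : GL M -> GL N -> GL (M *m N).
Proof.
case=> hM [M' [hM' MM' M'M]] [hN [N' [hN' NN' N'N]]].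
split; first exact: glM.
exists (N' *m M'); split; first exact: glM.
  by rewrite mulmxA -(mulmxA M) NN' mulmx1.
by rewrite mulmxA -(mulmxA N') M'M mulmx1.
Qed.

Lemma scalemxAr_even (a : A) M N : a \in par A false ->
  a *: (M *m N) = M *m (a *: N).
Proof.
move=> ha; apply/matrixP => i j; rewrite !mxE mulr_sumr.
by apply: eq_bigr => k _; rewrite !mxE !mulrA (even_comm _ ha).
Qed.

Lemma dual_mx_ext z w : map_mx dual_proj z = map_mx dual_proj w ->
  map_mx dual_coef z = map_mx dual_coef w -> z = w.
Proof.
move=> /matrixP hp /matrixP hc; apply/matrixP => i j.
by apply: dual_ext; [have := hp i j | have := hc i j]; rewrite !mxE.
Qed.

Lemma dual_projM z w : map_mx dual_proj (z *m w) =
  map_mx dual_proj z *m map_mx dual_proj w.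
Proof.
apply/matrixP => i j; rewrite !mxE (big_morph (@dual_proj A)
  (fun _ _ => erefl) (erefl : dual_proj 0 = 0)).
by apply: eq_bigr => k _; rewrite !mxE.
Qed.

Lemma dual_coefM z w : map_mx dual_coef (z *m w) =
  map_mx dual_proj z *m map_mx dual_coef w
    + map_mx dual_coef z *m map_mx dual_proj w.
Proof.
apply/matrixP => i j; rewrite !mxE (big_morph (@dual_coef A)
  (fun _ _ => erefl) (erefl : dual_coef 0 = 0)) -big_split.
by apply: eq_bigr => k _; rewrite !mxE.
Qed.

Lemma one_epsE M i j : one_eps M i j = DualNum ((i == j)%:R) (M i j).
Proof.
rewrite !mxE; apply: dual_ext; rewrite /= ?mul0r ?mul1r ?add0r ?addr0.
  by case: (i == j).
by case: (i == j); rewrite /= add0r.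
Qed.

Lemma one_eps_proj M : map_mx dual_proj (one_eps M) = 1%:M.
Proof. by apply/matrixP => i j; rewrite mxE one_epsE !mxE. Qed.

Lemma one_eps_coef M : map_mx dual_coef (one_eps M) = M.
Proof. by apply/matrixP => i j; rewrite mxE one_epsE. Qed.

Lemma one_eps_coefK z : map_mx dual_proj z = 1%:M ->
  z = one_eps (map_mx dual_coef z).
Proof.
by move=> hz; apply: dual_mx_ext; rewrite ?one_eps_proj ?one_eps_coef.
Qed.

(** Addition of tangent vectors is the group law, since \epsilon^2 = 0. *)
Lemma one_epsD M N : one_eps (M + N) = one_eps M *m one_eps N.
Proof.
apply: dual_mx_ext; first by rewrite dual_projM !one_eps_proj mulmx1.
by rewrite dual_coefM !one_eps_proj !one_eps_coef mul1mx mulmx1 addrC.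
Qed.

(** The relation g M g^-1 = N, expressed in A(\epsilon) and without
    inverting g. *)
Lemma dual_in_one_eps (g M N : 'M[A]_(m + n)) :
  map_mx dual_in g *m one_eps M = one_eps N *m map_mx dual_in g <->
  g *m M = N *m g.
Proof.
have dproj : map_mx dual_proj (map_mx dual_in g) = g.
  by apply/matrixP => i j; rewrite !mxE.
have dcoef : map_mx dual_coef (map_mx dual_in g) = 0.
  by apply/matrixP => i j; rewrite !mxE.
split=> [/(congr1 (map_mx dual_coef)) | gM].
  rewrite !dual_coefM !one_eps_proj !one_eps_coef dproj dcoef.
  by rewrite mul0mx mulmx0 add0r addr0.
apply: dual_mx_ext.
  by rewrite !dual_projM !one_eps_proj dproj mulmx1 mul1mx.
rewrite !dual_coefM !one_eps_proj !one_eps_coef dproj dcoef.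
by rewrite mul0mx mulmx0 add0r addr0.
Qed.

Lemma one_eps0 : one_eps (0 : 'M[A]_(m + n)) = 1%:M.
Proof.
apply/matrixP => i j; rewrite one_epsE !mxE.
by case: (i == j).
Qed.

Lemma one_eps_scale (a : A) M :
  one_eps (a *: M) = map_mx (dual_scale a) (one_eps M).
Proof. by apply/matrixP => i j; rewrite [RHS]mxE !one_epsE mxE. Qed.

Lemma gl_one_eps M : gl M -> gl (one_eps M).
Proof.
move=> /glP hM; have /glP h1 := gl1; apply/glP => i j.
by rewrite one_epsE inE /= hM; have := h1 i j; rewrite mxE => ->.
Qed.

Lemma GL_one_eps M : gl M -> GL (one_eps M).
Proof.
move=> hM; split; first exact: gl_one_eps.
exists (one_eps (- M)); split; first exact/gl_one_eps/glN.
  by rewrite -one_epsD subrr one_eps0.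
by rewrite -one_epsD addNr one_eps0.
Qed.

Lemma gl_dual_coef z : gl z -> gl (map_mx dual_coef z).
Proof.
by move=> /glP hz; apply/glP => i j; rewrite mxE; case/andP: (hz i j).
Qed.

End Closure.

Lemma one_eps_map (t : conj_kind) (A B : conjSuperAlgType R t)
    (f : conj_morphism A B) (M : 'M[A]_(m + n)) :
  one_eps (map_mx f M) = map_mx (dual_map_morphism f) (one_eps M).
Proof.
apply/matrixP => i j; rewrite [RHS]mxE !one_epsE mxE /=.
by congr DualNum; rewrite rmorph_nat.
Qed.

(** * Points of a supergroup *)

Section PointsMap.
Variables (X Y : superAlgType R) (f : {lrmorphism X -> Y}).
Hypothesis f_par : forall b (x : X), x \in par X b -> f x \in par Y b.

Lemma gl_map (M : 'M[X]_(m + n)) : gl M -> gl (map_mx f M).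
Proof. by move=> /glP hM; apply/glP => i j; rewrite mxE f_par. Qed.

Lemma entry_poly_eval_map P (M : 'M[X]_(m + n)) :
  entry_poly_eval P (map_mx f M) = f (entry_poly_eval P M).
Proof.
rewrite /entry_poly_eval rmorph_sum; apply: eq_bigr => u _.
rewrite /= linearZ /= rmorph_prod; congr (_ *: _).
by apply: eq_bigr => ij _; rewrite mxE.
Qed.

Lemma zero_locus_map Ps (M : 'M[X]_(m + n)) :
  zero_locus Ps M -> zero_locus Ps (map_mx f M).
Proof.
case=> -[hM [N [hN MN NM]]] hP; split=> [|P /hP hPM]; last first.
  by rewrite entry_poly_eval_map hPM rmorph0.
split; first exact: gl_map.
by exists (map_mx f N); split; [exact: gl_map | |];
  rewrite -map_mxM ?MN ?NM map_mx1.
Qed.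

(** The equations can be tested in a larger superalgebra, but not the
    invertibility. *)
Lemma zero_locus_reflect Ps (M : 'M[X]_(m + n)) : injective f -> GL M ->
  zero_locus Ps (map_mx f M) -> zero_locus Ps M.
Proof.
move=> f_inj hM [_ hP]; split=> // P /hP.
by rewrite entry_poly_eval_map => /eqP; rewrite -(rmorph0 f) inj_eq // => /eqP.
Qed.

End PointsMap.
End Supermatrices.

(** * The differential of a real structure *)

Lemma mulmx_rinv_inj (A : pzRingType) (p : nat) (g g' : 'M[A]_p) :
  g *m g' = 1%:M -> injective (mulmx^~ g : 'M_p -> 'M_p).
Proof.
by move=> gg' z w /(congr1 (mulmx^~ g')); rewrite -!mulmxA gg' !mulmx1.
Qed.

Section RealStructure.
Variables (R : realType) (t : conj_kind) (m n : nat) (G : supergroup R m n t).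

Lemma points_map (X Y : evalObj R t) (f : conj_morphism X Y)
    (z : 'M[X]_(m + n)) : points G z -> points G (map_mx f z).
Proof. by apply: zero_locus_map => b x; apply: conj_fun_par. Qed.

(** The closure of the points under products is only given over reduced
    superalgebras; for A(\epsilon) it is tested after [dual_embedding]. *)
Lemma pointsM (X : evalObj R t) (z w : 'M[X]_(m + n)) :
  points G z -> points G w -> points G (z *m w).
Proof.
case: X z w => A z w hz hw; first exact: supergroupM.
have [B [emb emb_inj]] := dual_embedding A.
apply: (zero_locus_reflect emb_inj); first by apply: GLM; [case: hz | case: hw].
by rewrite map_mxM; apply: (supergroupM (A := B)); apply: (points_map emb).
Qed.

Section LieAlgebra.
Variable A : redAlg R t.
Implicit Types (x y : 'M[A]_(m + n)) (g : 'M[A]_(m + n)) (a : A).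

Lemma LieD x y : Lie G A x -> Lie G A y -> Lie G A (x + y).
Proof.
move=> [hx px] [hy py]; split; first exact: glD.
by rewrite one_epsD; apply: (@pointsM (Dual A) _ _ px py).
Qed.

Lemma LieZ a x : a \in par A false -> Lie G A x -> Lie G A (a *: x).
Proof.
move=> ha [hx px]; split; first exact: glZ.
rewrite one_eps_scale.
apply: (zero_locus_map (f := dual_scale_lrmorphism ha)) px.
by move=> b u; apply: dual_scale_par.
Qed.

Lemma LieN x : Lie G A x -> Lie G A (- x).
Proof. by rewrite -scaleN1r; apply: LieZ; rewrite parN ?par_one. Qed.

(** If g x = y g, then Id + \epsilon y is the conjugate of Id + \epsilon x
    by g. *)
Lemma Lie_conj g x y : points G g -> Lie G A x -> gl y ->
  g *m x = y *m g -> Lie G A y.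
Proof.
move=> pg [_ px] hy gx; split; first exact: hy.
have [h [ph gh hg]] := supergroupV pg.
pose d := dual_in_morphism A : conj_morphism (Base A) (Dual A).
have pdg := points_map d pg; have pdh := points_map d ph.
suff -> : one_eps y = map_mx d g *m one_eps x *m map_mx d h.
  exact: (@pointsM (Dual A) _ _ (@pointsM (Dual A) _ _ pdg px) pdh).
have /dual_in_one_eps dgx := gx.
rewrite [map_mx d g *m _]dgx -mulmxA.
by rewrite -[map_mx dual_in g]/(map_mx d g) -map_mxM gh map_mx1 mulmx1.
Qed.

End LieAlgebra.

Variable Sigma : forall X : evalObj R t, 'M[X]_(m + n) -> 'M[X]_(m + n).
Hypothesis hSigma : real_structure G Sigma.

Lemma map_mx_inj (U V : Type) (f : U -> V) (p q : nat) :
  injective f -> injective (fun z : 'M[U]_(p, q) => map_mx f z).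
Proof.
move=> f_inj z w /matrixP zw; apply/matrixP => i j.
by have := zw i j; rewrite !mxE => /f_inj.
Qed.

(** For A(\epsilon), this and the next lemma follow by naturality along an
    injection into an object of the category. *)
Lemma SigmaM (X : evalObj R t) (z w : 'M[X]_(m + n)) :
  points G z -> points G w -> Sigma (z *m w) = Sigma z *m Sigma w.
Proof.
case: X z w => A z w hz hw; first exact: (Sigma_mul hSigma).
have [B [emb /map_mx_inj emb_inj]] := dual_embedding A.
apply: emb_inj; rewrite /= map_mxM.
rewrite -!(Sigma_natural hSigma emb) //; last exact: pointsM.
by rewrite map_mxM (Sigma_mul hSigma) //; apply: (points_map emb).
Qed.

Lemma SigmaK (X : evalObj R t) (z : 'M[X]_(m + n)) :
  points G z -> Sigma (Sigma z) = z.
Proof.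
case: X z => A z hz; first exact: (Sigma_invol hSigma).
have [B [emb /map_mx_inj emb_inj]] := dual_embedding A.
apply: emb_inj; rewrite /= -!(Sigma_natural hSigma emb) //; last first.
  exact: (Sigma_points hSigma).
by rewrite (Sigma_invol hSigma) //; apply: (points_map emb).
Qed.

(** The image of the identity is an invertible idempotent. *)
Lemma Sigma1 (A : redAlg R t) : Sigma (1%:M : 'M[Base A]_(m + n)) = 1%:M.
Proof.
have p1 := supergroup1 G A.
have [[_ [h [_ _ hS]]] _] := Sigma_points hSigma (X := Base A) p1.
have := SigmaM (X := Base A) p1 p1; rewrite mulmx1 => /(congr1 (mulmx h)).
by rewrite mulmxA hS mul1mx.
Qed.

Definition dual_Sigma (A : redAlg R t) :
    'M[dual A]_(m + n) -> 'M[dual A]_(m + n) :=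
  Sigma (X := Dual A).

(** The differential of [Sigma] at the identity. *)
Definition Lie_diff (A : redAlg R t) (x : 'M[A]_(m + n)) : 'M[A]_(m + n) :=
  map_mx dual_coef (dual_Sigma (one_eps x)).

Section OneAlgebra.
Variable A : redAlg R t.
Implicit Types (x y : 'M[A]_(m + n)) (g : 'M[A]_(m + n)) (a : A).
Implicit Types z w : 'M[dual A]_(m + n).

Lemma dual_SigmaM z w : points G z -> points G w ->
  dual_Sigma (z *m w) = dual_Sigma z *m dual_Sigma w.
Proof. exact: (SigmaM (X := Dual A)). Qed.

Lemma dual_SigmaK z : points G z -> dual_Sigma (dual_Sigma z) = z.
Proof. exact: (SigmaK (X := Dual A)). Qed.

Lemma dual_Sigma_scale a z : a \in par A false -> points G z ->
  map_mx dual_proj z = 1%:M ->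
  dual_Sigma (map_mx (dual_scale a) z) =
  map_mx (dual_scale (hat a)) (dual_Sigma z).
Proof. exact: (Sigma_dual_scale hSigma). Qed.

Lemma dual_Sigma_in g : points G g ->
  dual_Sigma (map_mx dual_in g) = map_mx dual_in (Sigma (X := Base A) g).
Proof.
exact: (Sigma_natural hSigma
  (dual_in_morphism A : conj_morphism (Base A) (Dual A))).
Qed.

Lemma dual_Sigma_proj z : points G z ->
  map_mx dual_proj (dual_Sigma z) = Sigma (X := Base A) (map_mx dual_proj z).
Proof.
move=> pz; exact: (esym (Sigma_natural hSigma
  (dual_proj_morphism A : conj_morphism (Dual A) (Base A)) pz)).
Qed.

Lemma Sigma_one_eps x : Lie G A x ->
  dual_Sigma (one_eps x) = one_eps (Lie_diff x).
Proof.
case=> hx px; apply: one_eps_coefK.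
by rewrite dual_Sigma_proj // one_eps_proj Sigma1.
Qed.

Lemma Lie_diff_eq x y : dual_Sigma (one_eps x) = one_eps y -> Lie_diff x = y.
Proof. by rewrite /Lie_diff => ->; apply: one_eps_coef. Qed.

Lemma Lie_diff_Lie x : Lie G A x -> Lie G A (Lie_diff x).
Proof.
move=> hx; have pS : points G (dual_Sigma (one_eps x)).
  exact: (Sigma_points hSigma (X := Dual A) hx.2).
split; first by case: pS => -[hS _] _; apply: gl_dual_coef.
by rewrite -Sigma_one_eps.
Qed.

Lemma Lie_diffK x : Lie G A x -> Lie_diff (Lie_diff x) = x.
Proof.
move=> hx; apply: Lie_diff_eq; rewrite -(Sigma_one_eps hx).
exact: dual_SigmaK hx.2.
Qed.

Lemma Lie_diffD x y : Lie G A x -> Lie G A y ->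
  Lie_diff (x + y) = Lie_diff x + Lie_diff y.
Proof.
move=> hx hy; apply: Lie_diff_eq.
rewrite (one_epsD x y) (one_epsD (Lie_diff x)) (dual_SigmaM hx.2 hy.2).
by congr (_ *m _); apply: Sigma_one_eps.
Qed.

Lemma Lie_diffZ a x : a \in par A false -> Lie G A x ->
  Lie_diff (a *: x) = hat a *: Lie_diff x.
Proof.
move=> ha hx; apply: Lie_diff_eq.
rewrite (one_eps_scale a x) (one_eps_scale (hat a)).
by rewrite (dual_Sigma_scale ha hx.2 (one_eps_proj x)) (Sigma_one_eps hx).
Qed.

Lemma Lie_diffN x : Lie G A x -> Lie_diff (- x) = - Lie_diff x.
Proof.
by move=> hx; rewrite -scaleN1r Lie_diffZ ?parN ?par_one // hatN hat1 scaleN1r.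
Qed.

(** Equivariance under the adjoint action: with g x g^-1 = y, apply \Sigma to
    g (Id + \epsilon x) = (Id + \epsilon y) g. *)
Lemma Lie_diff_conj g x y : points G g -> Lie G A x -> Lie G A y ->
  g *m x = y *m g ->
  Sigma (X := Base A) g *m Lie_diff x = Lie_diff y *m Sigma (X := Base A) g.
Proof.
move=> pg hx hy /dual_in_one_eps gx; apply/dual_in_one_eps.
have pd : points G (map_mx dual_in g).
  exact: (points_map (dual_in_morphism A : conj_morphism (Base A) (Dual A))).
transitivity (dual_Sigma (map_mx dual_in g *m one_eps x)).
  apply/esym/(etrans (dual_SigmaM pd hx.2)).
  by congr (_ *m _); [apply: dual_Sigma_in | apply: Sigma_one_eps].
rewrite gx; apply: etrans (dual_SigmaM hy.2 pd) _.
by congr (_ *m _); [apply: Sigma_one_eps | apply: dual_Sigma_in].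
Qed.

End OneAlgebra.

Lemma Lie_map (A B : redAlg R t) (f : conj_morphism A B) (x : 'M[A]_(m + n)) :
  Lie G A x -> Lie G B (map_mx f x).
Proof.
case=> hx px; split; first by apply: gl_map hx => b; apply: conj_fun_par.
by rewrite one_eps_map; apply: (@points_map (Dual A) (Dual B) _ _ px).
Qed.

Lemma Lie_diff_natural (A B : redAlg R t) (f : conj_morphism A B)
    (x : 'M[A]_(m + n)) : Lie G A x ->
  Lie_diff (map_mx f x) = map_mx f (Lie_diff x).
Proof.
move=> hx; apply: Lie_diff_eq.
rewrite (one_eps_map f x) (one_eps_map f (Lie_diff x)).
rewrite -(Sigma_one_eps hx).
exact: (Sigma_natural hSigma (dual_map_morphism f :
  conj_morphism (Dual A) (Dual B)) hx.2).
Qed.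

Section Bracket.
Variables (A B : redAlg R t) (emb : conj_morphism (Dual A) (Base B)).
Hypothesis emb_inj : injective emb.
Implicit Types x y : 'M[A]_(m + n).

Let inc : conj_morphism A B := conj_comp emb (dual_in_morphism A).
Let e : B := emb dual_eps.

Let e_even : e \in par B false.
Proof. by apply: conj_fun_par; rewrite inE /= par0 par_one. Qed.

Let ee : e * e = 0.
Proof.
rewrite -rmorphM -[RHS](rmorph0 emb); congr (emb _).
by congr DualNum; rewrite ?mul0r ?mulr0 ?addr0.
Qed.

Let hat_e : hat e = e.
Proof.
rewrite -conj_fun_hat; congr (emb _).
by congr DualNum; rewrite ?hat0 ?hat1.
Qed.

Let e_inc (a : A) : e * inc a = emb (DualNum 0 a).
Proof.
rewrite -rmorphM; congr (emb _).
by congr DualNum; rewrite /= ?mul0r ?mul1r ?add0r.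
Qed.

Let e_inc_inj x y : e *: map_mx inc x = e *: map_mx inc y -> x = y.
Proof.
move=> /matrixP xy; apply/matrixP => i j.
by have := xy i j; rewrite !mxE !e_inc => /emb_inj [].
Qed.

Let emb_one_eps x : map_mx emb (one_eps x) = 1%:M + e *: map_mx inc x.
Proof.
apply/matrixP => i j; rewrite [LHS]mxE one_epsE !mxE e_inc.
rewrite -(rmorph_nat emb) -rmorphD; congr (emb _).
by apply: dual_ext; case: (i == j); rewrite /= ?addr0 ?add0r.
Qed.

(** Conjugation by Id + e x is Id + e (ad x), since e^2 = 0. *)
Let conj_bracket x y :
  (1%:M + e *: map_mx inc x) *m map_mx inc y =
  (map_mx inc y + e *: map_mx inc (bracket x y))
    *m (1%:M + e *: map_mx inc x).
Proof.
rewrite mulmxDl mul1mx mulmxDr mulmx1 mulmxDl -!scalemxAl.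
rewrite -!(scalemxAr_even _ _ e_even) scalerA ee scale0r addr0.
rewrite -addrA -scalerDr -!map_mxM -map_mxD; congr (_ + _ *: map_mx _ _).
by rewrite subrK.
Qed.

(** The map x + \epsilon y |-> x + \epsilon e y from A(\epsilon) to
    B(\epsilon) is injective although v_e is not: it only multiplies by e
    elements that come from A. *)
Let dual_e_inc : {lrmorphism dual A -> dual B} :=
  dual_scale_lrmorphism e_even \o dual_map_morphism inc.

Let dual_e_inc_inj : injective dual_e_inc.
Proof.
move=> [a b] [c d] [] /emb_inj [ac].
by rewrite -!/(inc _) !e_inc ac => /emb_inj [->].
Qed.

Let Lie_e_bracket x y : Lie G A x -> Lie G A y ->
  Lie G B (map_mx inc y + e *: map_mx inc (bracket x y)).
Proof.
move=> hx hy.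
apply: (Lie_conj (points_map emb hx.2) (Lie_map inc hy)).
  apply: glD; first exact: (Lie_map inc hy).1.
  apply/glZ/gl_map; [exact: e_even | by move=> b; apply: conj_fun_par |].
  exact: gl_bracket hx.1 hy.1.
by rewrite emb_one_eps conj_bracket.
Qed.

(** Subtracting y from its conjugate y + e [x, y] puts e [x, y] in Lie(G)(B);
    [dual_e_inc] then gives the equations of [x, y] over A. *)
Lemma Lie_bracket_emb x y : Lie G A x -> Lie G A y -> Lie G A (bracket x y).
Proof.
move=> hx hy; have hxy : gl (bracket x y) by apply: gl_bracket hx.1 hy.1.
split; first exact: hxy.
apply: (zero_locus_reflect dual_e_inc_inj); first exact: GL_one_eps.
have -> : map_mx dual_e_inc (one_eps (bracket x y)) =
    one_eps (e *: map_mx inc (bracket x y)).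
  rewrite one_eps_scale one_eps_map -map_mx_comp.
  by apply/matrixP => i j; rewrite !mxE.
have [_] := LieD (Lie_e_bracket hx hy) (LieN (Lie_map inc hy)).
by rewrite addrC addKr.
Qed.

Lemma Lie_diff_bracket_emb x y : Lie G A x -> Lie G A y ->
  Lie_diff (bracket x y) = bracket (Lie_diff x) (Lie_diff y).
Proof.
move=> hx hy; apply: e_inc_inj.
have hb := Lie_map inc (Lie_bracket_emb hx hy).
have pg := points_map emb hx.2.
have := Lie_diff_conj pg (Lie_map inc hy) (Lie_e_bracket hx hy).
have -> : Sigma (X := Base B) (map_mx emb (one_eps x)) =
    1%:M + e *: map_mx inc (Lie_diff x).
  rewrite -emb_one_eps -Sigma_one_eps //.
  exact: (Sigma_natural hSigma emb hx.2).
rewrite emb_one_eps conj_bracket => /(_ erefl).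
rewrite (Lie_diffD (Lie_map inc hy) (LieZ e_even hb)) (Lie_diffZ e_even hb).
rewrite (Lie_diff_natural inc hy).
rewrite (Lie_diff_natural inc (Lie_bracket_emb hx hy)).
rewrite hat_e => /(etrans (esym (conj_bracket (Lie_diff x) (Lie_diff y)))).
have [g' gg'] : exists g',
    (1%:M + e *: map_mx inc (Lie_diff x)) *m g' = 1%:M :> 'M[B]_(m + n).
  have [_ /(points_map emb)] := Lie_diff_Lie hx.
  by rewrite emb_one_eps => -[[_ [g' [_ gg' _]]] _]; exists g'.
by move/(mulmx_rinv_inj gg')/addrI.
Qed.

End Bracket.

Lemma Lie_diff_bracket (A : redAlg R t) (x y : 'M[A]_(m + n)) :
  Lie G A x -> Lie G A y ->
  Lie_diff (bracket x y) = bracket (Lie_diff x) (Lie_diff y).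
Proof.
have [B [emb emb_inj]] := dual_embedding A.
exact: (Lie_diff_bracket_emb emb_inj).
Qed.

(** Complex scalars contain 1/2. *)
Lemma double_eq0 (A : superAlgType R) (a : A) : a = - a -> a = 0.
Proof.
move=> aN; have a2 : (2 : R[i]) *: a = 0.
  by rewrite scaler_nat mulr2n {2}aN subrr.
have two0 : (2 : R[i]) != 0 by rewrite Num.Theory.pnatr_eq0.
by rewrite -[a]scale1r -(mulVf two0) -scalerA a2 scaler0.
Qed.

Section Parity.
Variable A : redAlg R t.
Implicit Type x : 'M[A]_(m + n).

Let s := parity_morphism A.

Lemma parity_mxE x i j : gl x ->
  map_mx s x i j = (-1) ^+ (odd_index i (+) odd_index j) * x i j.
Proof. by move=> /glP hx; rewrite mxE; apply: parity_inv_par. Qed.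

(** The even elements are the fixed points of the parity automorphism, and the
    odd elements are those that it negates. *)
Lemma even_mx_parity x : gl x -> even_mx x <-> map_mx s x = x.
Proof.
move=> hx; rewrite even_mxP; split=> [x0 | sx i j oij].
  apply/matrixP => i j; rewrite parity_mxE //.
  by case: (boolP (_ (+) _)) => [/x0 ->|]; rewrite ?mulr0 ?mul1r.
have /matrixP/(_ i j) := sx.
by rewrite parity_mxE // oij mulN1r => /esym/double_eq0.
Qed.

Lemma odd_mx_parity x : gl x -> odd_mx x <-> map_mx s x = - x.
Proof.
move=> hx; rewrite odd_mxP; split=> [x0 | sx i j oij].
  apply/matrixP => i j; rewrite parity_mxE // mxE.
  by case: (boolP (_ (+) _)) => [|/x0 ->]; rewrite ?mulr0 ?oppr0 ?mulN1r.
have /matrixP/(_ i j) := sx.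
by rewrite parity_mxE // (negPf oij) mul1r mxE => /double_eq0.
Qed.

Lemma Lie_diff_even x : Lie G A x -> even_mx x -> even_mx (Lie_diff x).
Proof.
move=> hx /(even_mx_parity hx.1) sx; apply/(even_mx_parity (Lie_diff_Lie hx).1).
by rewrite -[LHS](Lie_diff_natural s hx) sx.
Qed.

Lemma Lie_diff_odd x : Lie G A x -> odd_mx x -> odd_mx (Lie_diff x).
Proof.
move=> hx /(odd_mx_parity hx.1) sx; apply/(odd_mx_parity (Lie_diff_Lie hx).1).
by rewrite -[LHS](Lie_diff_natural s hx) sx (Lie_diffN hx).
Qed.

End Parity.
End RealStructure.

Theorem theorem3p1 (R : realType) (t : conj_kind) (m n : nat)
    (G : supergroup R m n t)
    (Sigma : forall X : evalObj R t, 'M[X]_(m + n) -> 'M[X]_(m + n))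
    (hSigma : real_structure G Sigma) :
  exists Phi : forall A : redAlg R t, 'M[A]_(m + n) -> 'M[A]_(m + n),
    (forall (A : redAlg R t) (M : 'M[A]_(m + n)), Lie G A M ->
       Sigma (Dual A) (one_eps M) = one_eps (Phi A M))
    /\ Lie_real_structure (Lie G) Phi.
Proof.
exists (fun A => @Lie_diff R t m n Sigma A); split.
  by move=> A M; apply: (Sigma_one_eps hSigma).
split=> [A|A B f|A a b|A|A|A|A] x.
- exact: (Lie_diff_Lie hSigma).
- exact: (Lie_diff_natural hSigma).
- move=> y ha hb hx hy.
  apply: etrans (Lie_diffD hSigma (LieZ ha hx) (LieZ hb hy)) _.
  by congr (_ + _); apply: (Lie_diffZ hSigma).
- exact: (Lie_diffK hSigma).
- exact: (Lie_diff_bracket hSigma).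
- exact: (Lie_diff_even hSigma).
- exact: (Lie_diff_odd hSigma).
Qed.
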